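(* For an arbitrary finite undirected graph $G$, the neighborhood complex $\mathcal N(G)$ and the polyhedral complex $\mathrm{Hom}(K_2,G)$ have the same simple homotopy type.
   Context: For $S\subseteq V(G)$, $N(S)$ denotes the set of common neighbors of all vertices in $S$. The neighborhood complex $\mathcal N(G)$ is the simplicial complex whose vertices are the non-isolated vertices of $G$ and whose simplices are the nonempty subsets $S\subseteq V(G)$ with $N(S)\neq\emptyset$. $\Delta^{V(G)}$ is the simplex with vertex set $V(G)$, whose faces are identified with nonempty subsets of $V(G)$. $\mathrm{Hom}(K_2,G)$ is the polyhedral subcomplex of $\Delta^{V(G)}\times\Delta^{V(G)}$ consisting of all cells $\sigma\times\tau$ ($\sigma,\tau\subseteq V(G)$ nonempty) such that $(x,y)\in E(G)$ for all $x\in\sigma,y\in\tau$ (i.e. $(\sigma,\tau)$ is a complete bipartite subgraph of $G$). Two complexes have the same simple homotopy type if they are connected by a finite sequence of elementary collapses and elementary expansions. *)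

(* Defs.v *)
From HB Require Import structures.
From mathcomp Require Import all_boot all_order all_algebra.
From mathcomp Require Import all_classical all_reals all_analysis.
From Stdlib Require Import Relation_Operators.

Set Implicit Arguments.
Unset Strict Implicit.
Unset Printing Implicit Defensive.

Import Order.TTheory GRing.Theory Num.Theory.
Import numFieldNormedType.Exports.
Local Open Scope classical_set_scope.
Local Open Scope ring_scope.

(* Finite regular CW complexes, given by their face posets.            *)

Record cplx := Cplx { c_T : finType; c_le : rel c_T; c_cells : {set c_T} }.

(* Geometric realization of the order complex of (B, le), as a subset of
   R^T (coordinates indexed through enum_rank): points of the standard
   simplex on T supported on a chain of B. *)
Definition order_complex_real (R : realType) (T : finType) (le : rel T)
    (B : {set T}) : set 'rV[R]_#|T| :=
  [set x | (forall t, 0 <= x ord0 (enum_rank t)) /\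
           (forall t, t \notin B -> x ord0 (enum_rank t) = 0) /\
           (\sum_(t : T) x ord0 (enum_rank t) = 1) /\
           (forall s t, x ord0 (enum_rank s) != 0 -> x ord0 (enum_rank t) != 0 ->
               le s t || le t s)].

(* The unit sphere S^(n-1) in R^n (empty for n = 0). *)
Definition sphere (R : realType) (n : nat) : set 'rV[R]_n :=
  [set y | \sum_(i < n) (y ord0 i) ^+ 2 = 1].

Definition homeomorphic (U V : topologicalType) (A : set U) (B : set V) : Prop :=
  exists (f : U -> V) (g : V -> U),
    [/\ (forall x, A x -> B (f x)), (forall y, B y -> A (g y)),
        (forall x, A x -> g (f x) = x) & (forall y, B y -> f (g y) = y)] /\
    ({within A, continuous f} /\ {within B, continuous g}).

Definition is_poset_on (T : finType) (le : rel T) (A : {set T}) : Prop :=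
  [/\ (forall x, x \in A -> le x x),
      (forall x y, x \in A -> y \in A -> le x y -> le y x -> x = y) &
      (forall x y z, x \in A -> y \in A -> z \in A -> le x y -> le y z -> le x z)].

(* Bjorner's CW posets = face posets of finite regular CW complexes:
   the order complex of every open lower interval is homeomorphic to a sphere. *)
Definition CW_poset (R : realType) (X : cplx) : Prop :=
  is_poset_on (@c_le X) (c_cells X) /\
  forall x, x \in c_cells X ->
    exists n : nat,
      homeomorphic
        (@order_complex_real R (c_T X) (@c_le X)
           [set y in c_cells X | (y != x) && c_le y x])
        (@sphere R n).

Definition cplx_iso (X Y : cplx) : Prop :=
  exists f : c_T X -> c_T Y,
    [/\ {in c_cells X &, injective f},
        f @: c_cells X = c_cells Y &
        {in c_cells X &, forall x y, c_le (f x) (f y) = c_le x y}].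

Definition elem_collapse (R : realType) (X Y : cplx) : Prop :=
  CW_poset R X /\
  exists sigma tau : c_T X,
    [/\ sigma \in c_cells X, tau \in c_cells X, sigma != tau & c_le sigma tau] /\
    [/\ (forall r, r \in c_cells X -> c_le sigma r -> r = sigma \/ r = tau),
        (forall r, r \in c_cells X -> c_le tau r -> r = tau) &
        cplx_iso (@Cplx (c_T X) (@c_le X) (c_cells X :\ sigma :\ tau)) Y].

Definition sh_step (R : realType) (X Y : cplx) : Prop :=
  cplx_iso X Y \/ elem_collapse R X Y \/ elem_collapse R Y X.

Definition same_simple_homotopy_type (R : realType) (X Y : cplx) : Prop :=
  clos_refl_sym_trans cplx (sh_step R) X Y.

(* Graphs: V finite, adj a symmetric relation (loops allowed).         *)

Definition common_nbrs (V : finType) (adj : rel V) (S : {set V}) : {set V} :=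
  [set v | [forall x in S, adj x v]].

Definition nbhd_complex (V : finType) (adj : rel V) : cplx :=
  @Cplx {set V} (fun S1 S2 : {set V} => S1 \subset S2)
    [set S : {set V} | (S != finset.set0) && (common_nbrs adj S != finset.set0)].

(* Face poset of Hom(K_2, G): cells sigma x tau (sigma, tau nonempty) with
   (x,y) an edge for all x in sigma, y in tau, ordered by inclusion of
   products, i.e. componentwise inclusion. *)
Definition hom_K2 (V : finType) (adj : rel V) : cplx :=
  @Cplx ({set V} * {set V})%type
    (fun p q : {set V} * {set V} => (p.1 \subset q.1) && (p.2 \subset q.2))
    [set p : {set V} * {set V} | [&& p.1 != finset.set0, p.2 != finset.set0 &
                                   [forall x in p.1, forall y in p.2, adj x y]]].

(* Main.v *)
Require Import Defs.
From HB Require Import structures.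
From mathcomp Require Import all_boot all_order all_algebra.
From mathcomp Require Import all_classical all_reals all_analysis.
From mathcomp Require Import ring.
From Stdlib Require Import Relation_Operators.

(* Add to V(G) a new vertex, the apex, adjacent to every vertex on the left, and consider
   the complex Z of all products sigma x tau with sigma a simplex of N(G) and tau a
   nonempty set of common neighbors of sigma, possibly containing the apex. Toggling the
   apex in tau collapses Z onto the cells sigma x {apex}, a copy of N(G). Toggling in tau
   a common neighbor of sigma, chosen as a function of sigma, with larger sigma treated
   first, collapses the cells whose tau contains the apex, and leaves Hom(K_2, G).

   All complexes involved are down-closed sets of products of two simplices, encoded as
   subsets U of the disjoint union E of the two vertex sets that meet both blocks of E.
   The boundary of the cell X is a sphere: sending a point w of the order complex to the
   function e |-> sum of w(U) over U containing e identifies it with the functions on X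
   having maximum 1 on each block and minimum 0. Subtracting on each block the
   value at a base point turns these into the unit sphere of a gauge on a vector space,
   and a radial projection ends the proof. *)

Set Implicit Arguments.
Unset Strict Implicit.
Unset Printing Implicit Defensive.

Import Order.TTheory GRing.Theory Num.Theory.
Import numFieldNormedType.Exports.

(** * Heights on a product of simplices *)

Section ChainWeights.
Local Open Scope ring_scope.
Variables (R : realType) (E : finType).
Implicit Types (U W X : {set E}) (A : {set {set E}}) (w : {set E} -> R).

(** The total mass [M] is a parameter because heights are decomposed by peeling off mass
    inductively. *)
Definition chain_weight A (M : R) w : Prop :=
  [/\ (forall U, 0 <= w U), (forall U, U \notin A -> w U = 0),
      \sum_U w U = M &
      (forall U W, w U != 0 -> w W != 0 -> (U \subset W) || (W \subset U))].

Definition zeta w (e : E) : R := \sum_(U : {set E} | e \in U) w U.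

(* On chain-supported weights this inverts [zeta]. Heights on [X] lie in [0, 1],
   so the default values [1] and [0] only matter for empty index sets. *)
Definition level_weight X U (z : E -> R) : R :=
  Num.max 0 (\big[Num.min/1]_(e in U) z e - \big[Num.max/0]_(e in X :\: U) z e).

Lemma eq_level_weight X U (z z' : E -> R) :
  U \subset X -> {in X, z =1 z'} -> level_weight X U z = level_weight X U z'.
Proof.
move=> /fintype.subsetP UX zz'; rewrite /level_weight.
congr (Num.max 0 (_ - _)); apply: eq_bigr => e; first by move=> /UX /zz'.
by rewrite inE => /andP[_ /zz'].
Qed.

Lemma chain_max A W0 : W0 \in A ->
  {in A &, forall U W, (U \subset W) || (W \subset U)} ->
  exists2 W, W \in A & {in A, forall U, U \subset W}.
Proof.
move=> W0A chA; case: (@arg_maxnP _ W0 (mem A) (fun W => #|W|) W0A) => W WA Wmax.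
exists W => // U UA; case/orP: (chA _ _ UA WA) => // WU.
by have /eqP <- : W == U by rewrite eqEcard WU; exact: Wmax.
Qed.

Lemma chain_min A W0 : W0 \in A ->
  {in A &, forall U W, (U \subset W) || (W \subset U)} ->
  exists2 W, W \in A & {in A, forall U, W \subset U}.
Proof.
move=> W0A chA; case: (@arg_minnP _ W0 (mem A) (fun W => #|W|) W0A) => W WA Wmin.
exists W => // U UA; case/orP: (chA _ _ WA UA) => // UW.
by have /eqP -> : U == W by rewrite eqEcard UW; exact: Wmin.
Qed.

(** The support sets strictly inside [U] form a chain, so the largest contains all the others and
    still misses a point of [U]. *)
Lemma chain_avoid A M w U : chain_weight A M w -> U != finset.set0 ->
  exists2 e, e \in U & forall W, w W != 0 -> W \proper U -> e \notin W.
Proof.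
move=> [_ _ _ ch] /finset.set0Pn[e0 e0U].
have [[W0 W0A]|none] := pselect (exists W, W \in [set W | (w W != 0) && (W \proper U)]).
  have [|W + Wmax] := chain_max W0A.
    by move=> W W'; rewrite !inE => /andP[+ _] /andP[+ _]; exact: ch.
  rewrite inE => /andP[_ /fintype.properP[_ [e eU eW]]].
  exists e => // W' wW' W'U; apply: contra eW; apply: fintype.subsetP.
  by apply: Wmax; rewrite inE wW'.
by exists e0 => // W wW WU; case: none; exists W; rewrite inE wW.
Qed.

(** Dually, the smallest support set within [X] strictly above [U] has a point outside [U], shared
    by all larger ones. *)
Lemma chain_hit A M w U X : chain_weight A M w -> U \proper X ->
  exists2 e, e \in X :\: U &
    forall W, w W != 0 -> W \subset X -> U \proper W -> e \in W.
Proof.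
move=> [_ _ _ ch] /fintype.properP[_ [e0 e0X e0U]].
have [[W0 W0A]|none] := pselect (exists W,
    W \in [set W | [&& w W != 0, W \subset X & U \proper W]]).
  have [|W + Wmin] := chain_min W0A.
    by move=> W W'; rewrite !inE => /andP[+ _] /andP[+ _]; exact: ch.
  rewrite inE => /and3P[_ /fintype.subsetP WX /fintype.properP[_ [e eW eU]]].
  exists e; first by rewrite inE eU WX.
  by move=> W' wW' W'X UW'; apply: (fintype.subsetP (Wmin W' _)); rewrite // inE wW' W'X.
exists e0; first by rewrite inE e0U.
by move=> W wW WX UW; case: none; exists W; rewrite inE wW WX.
Qed.

Lemma zeta_ge0 A M w e : chain_weight A M w -> 0 <= zeta w e.
Proof. by case=> w0 _ _ _; apply: sumr_ge0. Qed.

Lemma zeta_le A M w e : chain_weight A M w -> zeta w e <= M.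
Proof.
case=> w0 _ <- _; rewrite /zeta [leLHS]big_mkcond; apply: ler_sum => U _.
by case: ifP.
Qed.

Lemma zeta_sumE w e (P : pred {set E}) :
  (forall W, w W != 0 -> (e \in W) = P W) -> zeta w e = \sum_(W | P W) w W.
Proof.
move=> eP; rewrite /zeta big_mkcond [RHS]big_mkcond; apply: eq_bigr => W _.
have [->|wW] := eqVneq (w W) 0; first by rewrite !if_same.
by rewrite eP.
Qed.

(** If [U] is comparable with the whole support, the minimum over [U] is the mass of the sets
    containing [U], and the maximum over [X :\: U] is the mass of those strictly containing it. *)
Lemma level_weightK A w X U : (forall W, W \in A -> W \proper X) ->
  U != finset.set0 -> U \proper X -> chain_weight A 1 w ->
  level_weight X U (zeta w) = w U.
Proof.
move=> AX U0 UX cw; have [w0 wA _ ch] := cw.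
have wX W : w W != 0 -> W \subset X.
  by move=> wW; apply/proper_sub/AX; apply: contraNT wW => /wA ->.
rewrite /level_weight.
(* An incomparable support set [W] forces [w U = 0]. For [e] in [U] outside [W] and [e'] in [W]
   outside [U], every support set containing [e] contains [W], hence [e']; so the difference is at
   most 0 and gets truncated. *)
have [[W wW nUW]|comp] := pselect (exists2 W, w W != 0 &
    ~~ ((U \subset W) || (W \subset U))).
  have -> : w U = 0.
    by apply/eqP; apply: contraNT nUW => wU; apply: ch.
  apply/max_idPl; rewrite subr_le0.
  move: nUW; rewrite negb_or => /andP[/subsetPn[e eU eW] /subsetPn[e' e'W e'U]].
  have e'X : e' \in X :\: U by rewrite inE e'U (fintype.subsetP (wX _ wW)).
  apply: (le_trans (bigmin_le_cond _ _ eU)).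
  apply: le_trans (le_bigmax_cond _ _ e'X).
  rewrite /zeta big_mkcond [leRHS]big_mkcond; apply: ler_sum => W' _.
  have [->|wW'] := eqVneq (w W') 0; first by rewrite !if_same.
  case: ifP => eW'; last by case: ifP.
  case/orP: (ch _ _ wW wW') => [/fintype.subsetP->//|/fintype.subsetP/(_ _ eW')].
  by rewrite (negbTE eW).
have {}comp W : w W != 0 -> (U \subset W) || (W \subset U).
  by move=> wW; apply: contra_notT comp => nUW; exists W.
have -> : \big[Num.min/1]_(e in U) zeta w e = \sum_(W : {set E} | U \subset W) w W.
  have [e eU eavoid] := chain_avoid cw U0.
  have ze : zeta w e = \sum_(W : {set E} | U \subset W) w W.
    apply: zeta_sumE => W wW; case: (boolP (U \subset W)) => [/fintype.subsetP->//|UW].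
    apply/negbTE; apply: eavoid => //.
    by have := comp _ wW; rewrite (negbTE UW) properE UW andbT.
  apply/eqP; rewrite eq_le; apply/andP; split.
    by rewrite -ze; apply: bigmin_le_cond.
  apply: le_bigmin; first by rewrite -ze; exact: zeta_le cw.
  move=> e' e'U; rewrite /zeta big_mkcond [leRHS]big_mkcond; apply: ler_sum => W _.
  by case: ifP => [/fintype.subsetP->//|_]; case: ifP.
have -> : \big[Num.max/0]_(e in X :\: U) zeta w e = \sum_(W : {set E} | U \proper W) w W.
  have [e eXU ehit] := chain_hit cw UX.
  have eU : e \notin U by move: eXU; rewrite inE => /andP[].
  have ze : zeta w e = \sum_(W : {set E} | U \proper W) w W.
    apply: zeta_sumE => W wW; case: (boolP (U \proper W)) => [UW|nUW].
      by apply: ehit => //; exact: wX.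
    apply/negbTE; apply: contra eU; apply: fintype.subsetP.
    have := comp _ wW; rewrite properE negb_and negbK in nUW *.
    by move/orP=> [UW|//]; move: nUW; rewrite UW.
  apply/eqP; rewrite eq_le; apply/andP; split; last first.
    by rewrite -ze; apply: le_bigmax_cond.
  apply: bigmax_le; first by rewrite -ze; exact: zeta_ge0 cw.
  move=> e'; rewrite inE => /andP[e'U e'X].
  rewrite /zeta big_mkcond [leRHS]big_mkcond; apply: ler_sum => W _.
  have [->|wW] := eqVneq (w W) 0; first by rewrite !if_same.
  case: ifP => e'W; last by case: ifP.
  rewrite properE; have nWU : ~~ (W \subset U) by apply/subsetPn; exists e'.
  by have := comp _ wW; rewrite (negbTE nWU) orbF => ->.
rewrite (bigD1 U) //=.
rewrite (eq_bigl (fun W => U \proper W)); last first.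
  by move=> W; rewrite finset.properEneq andbC eq_sym.
by rewrite addrK; apply/max_idPr.
Qed.

(** * Sets meeting every block and their heights *)

Variables (I : finType) (i0 : I) (pi : E -> I).

Definition full U := [forall i, [exists e in U, pi e == i]].

Definition proper_faces X : {set {set E}} := [set U | full U && (U \proper X)].

Lemma fullP U : reflect (forall i, exists2 e, e \in U & pi e = i) (full U).
Proof.
apply: (iffP forallP) => H i.
  by have /existsP[e /andP[eU /eqP ei]] := H i; exists e.
by have [e eU ei] := H i; apply/existsP; exists e; rewrite eU ei eqxx.
Qed.

Lemma full_neq0 U : full U -> U != finset.set0.
Proof. by move=> /fullP/(_ i0)[e eU _]; apply/finset.set0Pn; exists e. Qed.

Lemma sub_full U W : U \subset W -> full U -> full W.
Proof.
move=> /fintype.subsetP UW /fullP fU; apply/fullP => i.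
by have [e /UW eW ei] := fU i; exists e.
Qed.

(* For [M = 1], the image of the order complex of [proper_faces X] under [zeta]. *)
Definition height_function X (M : R) (z : E -> R) : Prop :=
  [/\ {in X, forall e, 0 <= z e}, {in X, forall e, z e <= M},
      (exists2 e, e \in X & z e = 0) &
      (forall i, exists e, [/\ e \in X, pi e = i & z e = M])].

(** Height 0 occurs at a point missed by the whole support, and height 1 at the points of the
    smallest support set, which meets every block. *)
Lemma zeta_height X w : X != finset.set0 ->
  chain_weight (proper_faces X) 1 w -> height_function X 1 (zeta w).
Proof.
move=> X0 cw; have [w0 wA w1 ch] := cw.
have wP W : w W != 0 -> W \in proper_faces X.
  by move=> wW; apply: contraNT wW => /wA ->.
split.
- by move=> e _; exact: zeta_ge0 cw.
- by move=> e _; exact: zeta_le cw.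
- have [e eX he] := chain_avoid cw X0; exists e => //.
  rewrite (@zeta_sumE _ _ pred0) ?big_pred0_eq // => W wW; apply/negbTE.
  by apply: he => //; have := wP _ wW; rewrite inE => /andP[].
move=> i.
have [W0 wW0] : exists W, W \in [set W | w W != 0].
  apply: contrapT => nW; have : (0 : R) = 1.
    rewrite -w1 big1 // => W _; apply/eqP; apply: contra_notT nW => wW.
    by exists W; rewrite inE.
  by move/eqP; rewrite eq_sym oner_eq0.
have [|W + Wmin] := chain_min wW0; first by move=> U W; rewrite !inE; exact: ch.
rewrite inE => /wP; rewrite inE => /andP[/fullP/(_ i)[e eW ei] WX].
exists e; split=> //; first by apply: (fintype.subsetP (proper_sub WX)).
rewrite (@zeta_sumE _ _ predT) // => W' wW'.
by rewrite (fintype.subsetP (Wmin W' _)) // inE.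
Qed.

(* Peel off the smallest positive value on the support of [z], which becomes
   the weight of that support. *)
Lemma height_decomposition X M (z : E -> R) : 0 <= M -> height_function X M z ->
  exists2 w, chain_weight (proper_faces X) M w & {in X, zeta w =1 z}.
Proof.
have [n] := ubnP #|[set e in X | 0 < z e]|.
elim: n z M => // n IHn z M; rewrite ltnS => leSn M0 [z0 zM [e0 e0X ze0] zi].
move: M0; rewrite le_eqVlt => /predU1P[M0|M0].
  exists (fun _ => 0); first by split=> //; [rewrite big1|move=> U W; rewrite eqxx].
  move=> e eX; rewrite /zeta big1 //; apply/eqP; rewrite eq_le z0 //=.
  by rewrite -M0 in zM; rewrite zM.
set S := [set e in X | 0 < z e] in leSn.
have SX : S \subset X by apply/fintype.subsetP => e; rewrite inE => /andP[].
have SP : S \in proper_faces X.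
  rewrite inE; apply/andP; split.
    apply/fullP => i; have [e [eX ei ze]] := zi i.
    by exists e => //; rewrite inE eX ze.
  rewrite properE SX; apply/subsetPn; exists e0 => //.
  by rewrite inE ze0 ltxx andbF.
have /andP[fS _] : full S && (S \proper X) by move: SP; rewrite inE.
have [e1 e1S _] := fullP _ fS i0.
case: (@arg_minP _ _ _ e1 (mem S) z e1S) => m mS mmin.
have {}mS : m \in S by [].
have [mX m0] : m \in X /\ 0 < z m by move: mS; rewrite inE => /andP[].
pose z' e := if e \in S then z e - z m else z e.
have z'ge0 : {in X, forall e, 0 <= z' e}.
  by move=> e eX; rewrite /z'; case: ifP => eS; rewrite ?z0 // subr_ge0 mmin.
have z'S e : e \in X -> 0 < z' e -> e \in S.
  move=> eX; rewrite /z'; case: ifP => // /negbT; rewrite inE eX /= -leNgt.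
  by move=> le0 /lt_le_trans/(_ le0); rewrite ltxx.
have [|||w cw zw] := IHn z' (M - z m).
- apply: leq_trans leSn; apply: proper_card; apply/fintype.properP; split.
    apply/fintype.subsetP => e; rewrite inE => /andP[eX]; exact: z'S.
  by exists m => //; rewrite inE mX /z' mS subrr ltxx.
- by rewrite subr_ge0 zM.
- split=> //.
  + move=> e eX; rewrite /z'; case: ifP => [_|/negbT]; first by rewrite lerD2r zM.
    by rewrite inE eX /= -leNgt => /le_trans; apply; rewrite subr_ge0 zM.
  + by exists e0 => //; rewrite /z' inE ze0 ltxx andbF.
  + move=> i; have [e [eX ei ze]] := zi i; exists e; split=> //.
    by rewrite /z' inE eX ze M0.
have [w0 wA wM ch] := cw.
(* Sets of nonzero weight lie in the support of [z'], which omits [m]; adding [S] on top therefore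
   keeps a chain. *)
have wS W : w W != 0 -> W \proper S.
  move=> wW; have WA : W \in proper_faces X by apply: contraNT wW => /wA ->.
  have WX : W \subset X by move: WA; rewrite inE => /andP[_ /proper_sub].
  have zW e : e \in W -> 0 < z' e.
    move=> eW; rewrite -zw ?(fintype.subsetP WX) //.
    rewrite /zeta (bigD1 W) //=; apply: ltr_pwDl; last exact: sumr_ge0.
    by rewrite lt_neqAle eq_sym wW w0.
  apply/fintype.properP; split.
    by apply/fintype.subsetP => e eW; apply: z'S (zW _ eW); apply: (fintype.subsetP WX).
  by exists m => //; apply/negP => /zW; rewrite /z' mS subrr ltxx.
exists (fun W => w W + (if W == S then z m else 0)).
  split.
  - by move=> W; rewrite addr_ge0 //; case: ifP => // _; exact: ltW.
  - move=> W WA; rewrite wA // add0r; case: eqP => // WS.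
    by rewrite WS SP in WA.
  - by rewrite big_split /= wM -big_mkcond big_pred1_eq subrK.
  - have nz W : w W + (if W == S then z m else 0) != 0 -> w W != 0 \/ W = S.
      by case: (W =P S) => [|_]; [right|rewrite addr0; left].
    move=> U W /nz[wU|->] /nz[wW|->]; rewrite ?subxx //.
    + exact: ch.
    + by rewrite (proper_sub (wS _ wU)).
    + by rewrite (proper_sub (wS _ wW)) orbT.
move=> e eX; rewrite /zeta big_split /= -/(zeta w e) zw //.
rewrite /z' -big_mkcondr /=; case: ifPn => eS.
  rewrite (big_pred1 S) ?subrK // => W; rewrite andbC /=.
  by case: eqP => // ->.
rewrite big_pred0 ?addr0 // => W; apply/negbTE; apply: contra eS.
by move=> /andP[eW /eqP<-].
Qed.

(** By [level_weightK] the weight built recursively in [height_decomposition] is given by a closed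
    formula, whose continuity in [z] is then easy to see. *)
Lemma height_level_weight X (z : E -> R) : height_function X 1 z ->
  let w := fun U => if U \in proper_faces X then level_weight X U z else 0 in
  chain_weight (proper_faces X) 1 w /\ {in X, zeta w =1 z}.
Proof.
move=> hz w; have [w' cw' zw'] := height_decomposition ler01 hz.
have [_ w'0 _ _] := cw'.
have -> // : w = w'.
apply/funext => U; rewrite /w; case: ifPn => [|/w'0->//].
rewrite inE => /andP[fU UX].
rewrite -(@level_weightK (proper_faces X) w' X) ?full_neq0 //; last first.
  by move=> W; rewrite inE => /andP[].
by apply: eq_level_weight; [exact: proper_sub|move=> e eX; rewrite zw'].
Qed.

End ChainWeights.

(** * Spherical boundaries *)

Section Continuity.
Local Open Scope ring_scope.
Variables (R : realType) (T : topologicalType).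
Implicit Types x : T.

Lemma eq_continuous_at (f g : T -> R) x :
  f =1 g -> {for x, continuous f} -> {for x, continuous g}.
Proof. by move=> /funext ->. Qed.

Lemma continuous_rowP n (f : T -> 'rV[R]_n) x :
  (forall j, {for x, continuous (fun y => f y ord0 j)}) -> {for x, continuous f}.
Proof.
move=> fx A [P Px PA].
have H : \forall y \near x, forall j, P ord0 j (f y ord0 j).
  by apply: filter_forall => j; apply: fx.
apply: filterS H => y yP; apply: PA => i j; rewrite ord1; exact: yP.
Qed.

Lemma continuous_bigop (op : R -> R -> R) (idx : R) (J : Type) (s : seq J)
    (P : pred J) (F : J -> T -> R) x :
  (forall f g : T -> R, {for x, continuous f} -> {for x, continuous g} ->
     {for x, continuous (fun y => op (f y) (g y))}) ->
  (forall j, P j -> {for x, continuous (F j)}) ->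
  {for x, continuous (fun y => \big[op/idx]_(j <- s | P j) F j y)}.
Proof.
move=> opc Fc; elim: s => [|j s IHs].
  apply: (@eq_continuous_at (fun=> idx)); last exact: cst_continuous.
  by move=> y; rewrite big_nil.
case Pj: (P j); last first.
  by apply: eq_continuous_at IHs => y; rewrite big_cons Pj.
by apply: eq_continuous_at (opc _ _ (Fc _ Pj) IHs) => y; rewrite big_cons Pj.
Qed.

Lemma continuous_sum (J : Type) (s : seq J) (P : pred J) (F : J -> T -> R) x :
  (forall j, P j -> {for x, continuous (F j)}) ->
  {for x, continuous (fun y => \sum_(j <- s | P j) F j y)}.
Proof. by apply: continuous_bigop => f g; exact: continuousD. Qed.

Lemma continuous_bigmax (J : Type) (s : seq J) (P : pred J) (F : J -> T -> R) a x :
  (forall j, P j -> {for x, continuous (F j)}) ->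
  {for x, continuous (fun y => \big[Num.max/a]_(j <- s | P j) F j y)}.
Proof. by apply: continuous_bigop => f g; exact: continuous_max. Qed.

Lemma continuous_bigmin (J : Type) (s : seq J) (P : pred J) (F : J -> T -> R) a x :
  (forall j, P j -> {for x, continuous (F j)}) ->
  {for x, continuous (fun y => \big[Num.min/a]_(j <- s | P j) F j y)}.
Proof. by apply: continuous_bigop => f g; exact: continuous_min. Qed.

Lemma continuous_level_weight (E : finType) (X U : {set E}) (z : T -> E -> R) x :
  (forall e, {for x, continuous (z^~ e)}) ->
  {for x, continuous (fun y => level_weight X U (z y))}.
Proof.
move=> zc; apply: continuous_max; first exact: cst_continuous.
apply: continuousB; first exact: continuous_bigmin.
exact: continuous_bigmax.
Qed.

End Continuity.

(** * Radial projection onto the unit sphere *)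

Section Sphere.
Local Open Scope ring_scope.
Variables (R : realType) (E I : finType) (i0 : I) (pi : E -> I) (r : I -> E).
Variable X : {set E}.
Hypotheses (pir : cancel r pi) (rX : forall i, r i \in X).

(* Subtracting the value at the base point [r i] of each block identifies the
   height functions with the boundary of a star-shaped neighbourhood of [0] in
   [R^D]; [radius] is its gauge. *)
Let D : {set E} := [set e in X | e != r (pi e)].

Definition weights (x : 'rV[R]_#|{set E}|) (U : {set E}) : R := x ord0 (enum_rank U).

Definition rel_height (w : {set E} -> R) (e : E) : R :=
  zeta w e - zeta w (r (pi e)).

Definition to_sphere (x : 'rV[R]_#|{set E}|) : 'rV[R]_#|D| :=
  \row_k (rel_height (weights x) (enum_val k) /
          Num.sqrt (\sum_(l < #|D|) rel_height (weights x) (enum_val l) ^+ 2)).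

Definition extend (y : 'rV[R]_#|D|) (e : E) : R :=
  \sum_(k < #|D| | enum_val k == e) y ord0 k.

(** The drop below the top of the block, insensitive to constants added on the block. The default 0
    does not alter the maximum, since base points have value 0. *)
Definition depth (y : 'rV[R]_#|D|) (e : E) : R :=
  \big[Num.max/0]_(e' in X | pi e' == pi e) extend y e' - extend y e.

Definition radius (y : 'rV[R]_#|D|) : R := \big[Num.max/0]_(e in X) depth y e.

(** For nonzero [y], the scaling puts the top of each block at height 1 and the deepest points at
    height 0. *)
Definition height (y : 'rV[R]_#|D|) (e : E) : R := 1 - depth y e / radius y.

Definition of_sphere (y : 'rV[R]_#|D|) : 'rV[R]_#|{set E}| :=
  \row_j (if enum_val j \in proper_faces pi X
          then level_weight X (enum_val j) (height y) else 0).

Let X0 : X != finset.set0.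
Proof. by apply/finset.set0Pn; exists (r i0). Qed.

Lemma weightsP x :
  order_complex_real (fun U W : {set E} => U \subset W) (proper_faces pi X) x <->
  chain_weight (proper_faces pi X) 1 (weights x).
Proof. by split; [case=> ? [? [? ?]]|case=> ? ? ? ?]. Qed.

Lemma extend_val y k : extend y (enum_val k) = y ord0 k.
Proof.
by rewrite /extend (big_pred1 k) // => l; rewrite /= (inj_eq enum_val_inj).
Qed.

Lemma extend_out y e : e \notin D -> extend y e = 0.
Proof.
move=> eD; rewrite /extend big_pred0 // => k; apply/negbTE.
by apply: contraNneq eD => <-; exact: enum_valP.
Qed.

Lemma extend_r y i : extend y (r i) = 0.
Proof. by rewrite extend_out // inE pir eqxx andbF. Qed.

Lemma depth_ge0 y e : e \in X -> 0 <= depth y e.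
Proof.
move=> eX; rewrite subr_ge0.
by apply: (le_bigmax_cond _ (extend y)); rewrite eX eqxx.
Qed.

Lemma depth_le y e : e \in X -> depth y e <= radius y.
Proof. by move=> eX; exact: le_bigmax_cond. Qed.

Lemma radius_ge0 y : 0 <= radius y.
Proof. exact: bigmax_ge_id. Qed.

Lemma block_top y i : exists e, [/\ e \in X, pi e = i & depth y e = 0].
Proof.
(* A maximum with default 0 is attained when all values are nonnegative, hence the restriction,
   which the base point [r i] satisfies. *)
have [||e] := @eq_bigmax _ _ _ 0 (r i) (fun e => (e \in [set e in X | pi e == i]) &&
   (0 <= extend y e)) (extend y).
- by rewrite !inE rX pir eqxx /= extend_r.
- by move=> e /andP[].
rewrite unfold_in !inE -andbA => /and3P[eX /eqP ei e0] emax.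
exists e; split=> //; apply/eqP; rewrite subr_eq0 -emax ei eq_le.
apply/andP; split; last first.
  by apply: sub_bigmax => e' /andP[]; rewrite !inE.
apply: bigmax_le => [|e' e'X]; first exact: bigmax_ge_id.
have [e'0|] := leP 0 (extend y e'); last first.
  by move=> /ltW/le_trans; apply; exact: bigmax_ge_id.
by apply: (le_bigmax_cond _ (extend y)); rewrite !inE e'X.
Qed.

(** If all depths vanish, [y] is constant on each block, with the value 0 of the base point. *)
Lemma radius_gt0 y : y != 0 -> 0 < radius y.
Proof.
apply: contraNT; rewrite -leNgt => rad0.
have dep0 e : e \in X -> depth y e = 0.
  move=> eX; apply/eqP; rewrite eq_le depth_ge0 // andbT.
  exact: le_trans (depth_le _ eX) rad0.
apply/eqP/rowP => k; rewrite mxE -extend_val.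
set e := enum_val k; have /[!inE]/andP[eX _] : e \in D by exact: enum_valP.
have := dep0 _ eX; have := dep0 _ (rX (pi e)).
by rewrite /depth pir extend_r => /eqP; rewrite subr0 => /eqP -> /eqP; rewrite sub0r oppr_eq0 => /eqP.
Qed.

Lemma height_heightP y : y != 0 -> height_function pi X 1 (height y).
Proof.
move=> y0; have rad0 := radius_gt0 y0; split.
- by move=> e eX; rewrite subr_ge0 ler_pdivrMr // mul1r depth_le.
- by move=> e eX; rewrite gerBl divr_ge0 ?depth_ge0 // radius_ge0.
- have [||e eX emax] := @eq_bigmax _ _ _ 0 (r i0) (mem X) (depth y).
  + exact: rX.
  + by move=> e; exact: depth_ge0.
  by exists e => //; rewrite /height -emax divff ?subrr // gt_eqF.
- move=> i; have [e [eX ei e0]] := block_top y i.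
  by exists e; rewrite /height e0 mul0r subr0.
Qed.

Lemma sphere_neq0 y : sphere y -> y != 0 :> 'rV[R]_#|D|.
Proof.
move=> y1; apply/eqP => y0; move: y1; rewrite /sphere /= y0.
under eq_bigr do rewrite mxE expr0n.
by rewrite big1 // => /eqP; rewrite eq_sym oner_eq0.
Qed.

Lemma weights_of_sphere y : weights (of_sphere y) =
  fun U => if U \in proper_faces pi X then level_weight X U (height y) else 0.
Proof. by apply/funext => U; rewrite /weights mxE enum_rankK. Qed.

Lemma of_sphere_order_complex y : y != 0 ->
  order_complex_real (fun U W : {set E} => U \subset W) (proper_faces pi X) (of_sphere y).
Proof.
move=> y0; apply/weightsP; rewrite weights_of_sphere.
by have [] := height_level_weight i0 (height_heightP y0).
Qed.

(** Otherwise heights would be constant on each block, but the block of a point of height 0 also has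
    a point of height 1. *)
Lemma rel_height_neq0 w : chain_weight (proper_faces pi X) 1 w ->
  0 < \sum_(k < #|D|) rel_height w (enum_val k) ^+ 2.
Proof.
move=> cw; have [z0 z1 [e eX ze] zi] := zeta_height X0 cw.
rewrite lt_neqAle sumr_ge0 ?andbT; last by move=> k _; exact: sqr_ge0.
apply/negP; rewrite eq_sym psumr_eq0; last by move=> k _; exact: sqr_ge0.
move=> /allP rel0.
have {}rel0 e' : e' \in X -> zeta w e' = zeta w (r (pi e')).
  move=> e'X; have [->|e'r] := eqVneq e' (r (pi e')); first by rewrite pir.
  have e'D : e' \in D by rewrite inE e'X.
  have := rel0 (enum_rank_in e'D e') (mem_index_enum _).
  by rewrite enum_rankK_in // sqrf_eq0 subr_eq0 => /eqP.
have [e1 [e1X e1e ze1]] := zi (pi e).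
by have := rel0 _ eX; rewrite ze -e1e -rel0 // ze1 => /eqP; rewrite eq_sym oner_eq0.
Qed.

Lemma to_sphere_sphere x : chain_weight (proper_faces pi X) 1 (weights x) ->
  sphere (to_sphere x).
Proof.
move=> /rel_height_neq0 s0; rewrite /sphere /=.
under eq_bigr do rewrite mxE expr_div_n sqr_sqrtr ?ltW //.
by rewrite -mulr_suml divff ?gt_eqF.
Qed.

(** With [c] the norm of the relative heights, depths become [(1 - z e) / c] because each block has
    maximum 1, and the radius becomes [c^-1] because the minimum is 0; so [c] cancels in
    [height]. *)
Lemma to_sphereK x : chain_weight (proper_faces pi X) 1 (weights x) ->
  of_sphere (to_sphere x) = x.
Proof.
move=> cw; have s0 := rel_height_neq0 cw.
set c := Num.sqrt (\sum_(k < #|D|) rel_height (weights x) (enum_val k) ^+ 2).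
have c0 : 0 < c by rewrite sqrtr_gt0.
set z := zeta (weights x).
have [z0 z1 [e0 e0X ze0] zi] := zeta_height X0 cw; rewrite -/z in z0 z1 ze0 zi.
have extE e : e \in X -> extend (to_sphere x) e = (z e - z (r (pi e))) / c.
  move=> eX; have [er|er] := eqVneq e (r (pi e)).
    by rewrite er extend_r pir subrr mul0r.
  have eD : e \in D by rewrite inE eX.
  by rewrite -(enum_rankK_in eD eD) extend_val mxE.
have depE e : e \in X -> depth (to_sphere x) e = (1 - z e) / c.
  move=> eX; rewrite /depth extE //.
  suff -> : \big[Num.max/0]_(e' in X | pi e' == pi e) extend (to_sphere x) e' =
      (1 - z (r (pi e))) / c by rewrite -mulrBl; congr (_ / _); ring.
  have [e1 [e1X e1e ze1]] := zi (pi e).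
  apply/eqP; rewrite eq_le; apply/andP; split.
    apply: bigmax_le => [|e' /andP[e'X /eqP e'e]].
      by rewrite divr_ge0 ?(ltW c0) // subr_ge0 z1 ?rX.
    by rewrite extE // e'e ler_pM2r ?invr_gt0 // lerD2r z1.
  rewrite -ze1 -e1e -extE //.
  by apply: (le_bigmax_cond _ (extend (to_sphere x))); rewrite e1X e1e eqxx.
have radE : radius (to_sphere x) = c^-1.
  apply/eqP; rewrite eq_le; apply/andP; split.
    apply: bigmax_le => [|e eX]; first by rewrite invr_ge0 ltW.
    by rewrite depE // ler_piMl ?invr_ge0 ?(ltW c0) // gerBl z0.
  have <- : depth (to_sphere x) e0 = c^-1 by rewrite depE // ze0 subr0 mul1r.
  exact: depth_le.
have hE : {in X, height (to_sphere x) =1 z}.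
  move=> e eX; rewrite /height depE // radE invrK divfK ?gt_eqF //.
  by ring.
apply/rowP => j; rewrite mxE; have [w0 wA _ _] := cw.
case: ifPn => [|/wA]; last by rewrite /weights enum_valK.
rewrite inE => /andP[fU UX]; rewrite (eq_level_weight (proper_sub UX) hE).
rewrite (@level_weightK _ _ (proper_faces pi X)) //; last exact: full_neq0 fU.
  by rewrite /weights enum_valK.
by move=> W; rewrite inE => /andP[].
Qed.

(** The relative heights of [of_sphere y] are [y] divided by [radius y]; as [y] has norm 1,
    normalizing removes that factor. *)
Lemma of_sphereK y : sphere y -> to_sphere (of_sphere y) = y.
Proof.
move=> y1; have y0 := sphere_neq0 y1; have rad0 := radius_gt0 y0.
have [_ zE] := height_level_weight i0 (height_heightP y0).
have relE k : rel_height (weights (of_sphere y)) (enum_val k) = y ord0 k / radius y.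
  have /[!inE]/andP[eX _] : enum_val k \in D by exact: enum_valP.
  rewrite /rel_height weights_of_sphere !zE // /height /depth pir extend_r extend_val.
  by ring.
apply/rowP => k; rewrite mxE relE.
under eq_bigr do rewrite relE expr_div_n.
rewrite -mulr_suml y1 mul1r sqrtrV ?exprn_ge0 ?radius_ge0 //.
by rewrite sqrtr_sqr ger0_norm ?radius_ge0 // invrK divfK // gt_eqF.
Qed.

Lemma to_sphere_continuous x : chain_weight (proper_faces pi X) 1 (weights x) ->
  {for x, continuous to_sphere}.
Proof.
move=> /rel_height_neq0 s0; apply: continuous_rowP => k.
apply: eq_continuous_at (fun y => esym (mxE _ _ _ _)) _.
have relc e : {for x, continuous (fun x => rel_height (weights x) e)}.
  by apply: continuousB; apply: continuous_sum => U _; exact: coord_continuous.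
apply: continuousM; first exact: relc.
apply: continuousV; first by rewrite gt_eqF // sqrtr_gt0.
apply: continuous_comp; last exact: sqrt_continuous.
apply: continuous_sum => l _.
apply: (@continuous_comp _ _ _ _ (fun u : R => u ^+ 2)); first exact: relc.
exact: exprn_continuous.
Qed.

Lemma of_sphere_continuous y : y != 0 -> {for y, continuous of_sphere}.
Proof.
move=> y0; apply: continuous_rowP => j.
apply: (@eq_continuous_at _ _ (fun y => if enum_val j \in proper_faces pi X
  then level_weight X (enum_val j) (height y) else 0)); first by move=> y'; rewrite mxE.
case: (enum_val j \in proper_faces pi X); last exact: cst_continuous.
have extc e : {for y, continuous (extend^~ e)}.
  by apply: continuous_sum => k _; exact: coord_continuous.
have depc e : {for y, continuous (depth^~ e)}.
  by apply: continuousB; [apply: continuous_bigmax => ? _|]; exact: extc.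
apply: continuous_level_weight => e.
apply: continuousB; first exact: cst_continuous.
apply: continuousM; first exact: depc.
apply: continuousV; first by rewrite gt_eqF // radius_gt0.
by apply: continuous_bigmax => ? _; exact: depc.
Qed.

Lemma proper_faces_sphere :
  homeomorphic
    (@order_complex_real R _ (fun U W : {set E} => U \subset W) (proper_faces pi X))
    (@sphere R #|D|).
Proof.
exists to_sphere, of_sphere; split; first split.
- by move=> x /weightsP; exact: to_sphere_sphere.
- by move=> y /sphere_neq0; exact: of_sphere_order_complex.
- by move=> x /weightsP; exact: to_sphereK.
- exact: of_sphereK.
split; apply: continuous_in_subspaceT => x; rewrite inE.
  by move=> /weightsP; exact: to_sphere_continuous.
by move=> /sphere_neq0; exact: of_sphere_continuous.
Qed.

End Sphere.

(** * Collapses *)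

Lemma cplx_iso_refl (X : cplx) : cplx_iso X X.
Proof. by exists id; split; [|exact: imset_id|]. Qed.

(** Reads a lexicographic comparison off keys written in base [N]. *)
Lemma lex_le a b c d N : a <= b -> d < N -> b * N + c <= a * N + d ->
  a = b /\ c <= d.
Proof.
rewrite leq_eqVlt => /predU1P[->|ab] dN; first by rewrite leq_add2l.
rewrite leqNgt (leq_trans _ (leq_addr _ _)) //.
by rewrite (leq_trans _ (leq_mul ab (leqnn N))) // mulSn addnC ltn_add2r.
Qed.

Section Collapses.
Variables (R : realType) (E I : finType) (i0 : I) (pi : E -> I).
Implicit Types (K L : {set {set E}}) (U W : {set E}).

Definition face_complex K : cplx := @Cplx {set E} (fun U W : {set E} => U \subset W) K.

(** One equation for two conditions: members are full (take [U = W]), and full subsets of members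
    are members. *)
Definition full_ideal K :=
  forall U W, W \in K -> U \subset W -> (U \in K) = full pi U.

(** The cells strictly below [X] are all of [proper_faces pi X], whatever [K] is; a choice of one
    base point per block then gives the sphere. *)
Lemma full_ideal_CW K : full_ideal K -> CW_poset R (face_complex K).
Proof.
move=> idK; split.
  split=> /= [U _|U W _ _ UW WU|U W W' _ _ _]; first exact: fintype.subxx.
    by apply/eqP; rewrite finset.eqEsubset UW WU.
  exact: fintype.subset_trans.
move=> X /= XK; have fX : full pi X by rewrite -(idK _ _ XK (fintype.subxx _)).
have [r rP] : exists r, forall i, r i \in X /\ pi (r i) = i.
  have /choice[r rP] : forall i, exists e, e \in X /\ pi e = i.
    by move=> i; have [e eX ei] := fullP _ _ fX i; exists e.
  by exists r.
exists #|[set e in X | e != r (pi e)]|.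
have -> : [set U in K | (U != X) && (U \subset X)] = proper_faces pi X.
  apply/setP => U; rewrite !inE finset.properEneq.
  case UX : (U \subset X); last by rewrite !andbF.
  by rewrite (idK _ _ XK UX).
have pir : cancel r pi by move=> i; have [] := rP i.
have rX i : r i \in X by have [] := rP i.
exact: (@proper_faces_sphere R _ _ i0 pi r X pir rX).
Qed.

Definition toggle (e : E) U : {set E} := if e \in U then U :\ e else e |: U.

(* The cells outside [L] are matched by toggling [phi U]; matched pairs are removed
   in decreasing lexicographic order of [(rho U, #|U|)]. *)
Lemma toggle_collapse (phi : {set E} -> E) (rho : {set E} -> nat) K L :
  full_ideal K -> full_ideal L -> L \subset K ->
  (forall U W, U \subset W -> rho U <= rho W) ->
  (forall U, U \in K :\: L ->
     toggle (phi U) U \in K :\: L /\ rho (toggle (phi U) U) = rho U) ->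
  (forall U W, U \in K :\: L -> W \in K :\: L -> U \subset W -> rho U = rho W ->
     phi U = phi W) ->
  same_simple_homotopy_type R (face_complex K) (face_complex L).
Proof.
have [n] := ubnP #|K|; elim: n K => // n IHn K.
rewrite ltnS => leKn idK idL LK rho_mono tog phi_loc.
have [[U0 U0KL]|none] := pselect (exists U, U \in K :\: L); last first.
  have -> : K = L.
    apply/eqP; rewrite finset.eqEsubset LK andbT; apply/fintype.subsetP => U UK.
    by apply/negPn/negP => UL; apply: none; exists U; rewrite inE UL.
  exact: rst_refl.
pose P := [set U in K :\: L | phi U \notin U].
have togP W : W \in K :\: L -> phi W \in W ->
    W :\ phi W \in P /\ phi (W :\ phi W) = phi W.
  move=> WKL pW; have := tog _ WKL; rewrite /toggle pW => -[W'KL rhoW'].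
  have phiW' : phi (W :\ phi W) = phi W by apply: phi_loc; rewrite ?subD1set.
  by rewrite inE W'KL phiW' !inE eqxx.
have [U1 U1P] : exists U, U \in P.
  have [pU|pU] := boolP (phi U0 \in U0); last by exists U0; rewrite inE U0KL.
  by exists (U0 :\ phi U0); have [] := togP _ U0KL pU.
(* [P] holds the lower members of the matched pairs, and the one with the largest key is a free
   face. The factor [#|E|.+1] exceeds every cardinal, so the key is lexicographic. *)
case: (@arg_maxnP _ U1 (mem P) (fun U => rho U * #|E|.+1 + #|U|) U1P) => U UP Umax.
have [UKL pU] : U \in K :\: L /\ phi U \notin U.
  by apply/andP; have : U \in P by []; rewrite inE.
set e := phi U in pU *.
have [eUKL rhoeU] : e |: U \in K :\: L /\ rho (e |: U) = rho U.
  by have := tog _ UKL; rewrite /toggle -/e (negbTE pU).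
have UsubU : U \subset e |: U by exact: subsetU1.
have phieU : phi (e |: U) = e by rewrite -(phi_loc U (e |: U)).
have lt_card W : #|W| < #|E|.+1 by rewrite ltnS max_card.
have above W : W \in K -> U \subset W -> W = U \/ W = e |: U.
  move=> WK UW.
  have WKL : W \in K :\: L.
    rewrite inE WK andbT; apply/negP => WL; move: UKL; rewrite inE.
    by rewrite (idK _ _ WK UW) (idL _ _ WL UW) andNb.
  have rhoUW := rho_mono _ _ UW.
  (* The lower member of the pair of [W] has the same [rho] as [W]. Maximality of [U] forces
     [rho W = rho U], hence [phi W = e], and leaves no room between [U] and that lower member. *)
  have [pW|pW] := boolP (phi W \in W).
    have [W'P phiW'] := togP _ WKL pW.
    have [_ rhoW'] := tog _ WKL; rewrite /toggle pW in rhoW'.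
    have := Umax _ W'P; rewrite rhoW' => /(lex_le rhoUW (lt_card U))[rhoE leW'].
    have eW : e = phi W by exact: phi_loc.
    have UW' : U \subset W :\ phi W by rewrite subsetD1 UW -eW.
    right; rewrite -(finset.setD1K pW) -eW; congr (_ |: _); apply/esym/eqP.
    by rewrite eqEcard eW UW'.
  have WP : W \in P by rewrite inE WKL.
  have /(lex_le rhoUW (lt_card U))[_ leW] := Umax _ WP.
  by left; apply/esym/eqP; rewrite eqEcard UW.
have above_top W : W \in K -> e |: U \subset W -> W = e |: U.
  move=> WK eUW; have [WU|//] := above _ WK (fintype.subset_trans UsubU eUW).
  by case/negP: pU; rewrite -WU; apply: (fintype.subsetP eUW); exact: finset.setU11.
pose K' := K :\ U :\ (e |: U).
have UK : U \in K by move: UKL; rewrite inE => /andP[].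
have eUK : e |: U \in K by move: eUKL; rewrite inE => /andP[].
have K'P W : (W \in K') = [&& W \in K, W != U & W != e |: U].
  by rewrite !inE; case: (W \in K); rewrite ?andbT ?andbF //= andbC.
(* A cell of [K] containing a removed cell is itself removed. *)
have idK' : full_ideal K'.
  move=> W' W; rewrite !K'P => /and3P[WK WU WeU] W'W.
  rewrite -(idK _ _ WK W'W); case: (boolP (W' \in K)) => //= W'K.
  apply/andP; split.
    by apply: contraNneq WU => W'U; case: (above W) WeU => [||->|->]; rewrite -?W'U ?eqxx.
  by apply: contraNneq WeU => W'U; rewrite [W]above_top // -W'U.
have K'L W : (W \in K' :\: L) = [&& W \in K :\: L, W != U & W != e |: U].
  by rewrite inE K'P inE andbA.
apply: rst_trans (face_complex K') _ _ _; last first.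
  apply: IHn => //.
  - apply: leq_trans leKn; apply: proper_card; apply/fintype.properP; split.
      by apply/fintype.subsetP => W; rewrite K'P => /and3P[].
    by exists U; rewrite ?K'P ?eqxx ?andbF.
  - apply/fintype.subsetP => W WL; rewrite K'P (fintype.subsetP LK) //=.
    move: UKL eUKL; rewrite !inE => /andP[UL _] /andP[eUL _].
    by rewrite (contraNneq _ UL) ?(contraNneq _ eUL) // => <-.
  (* Toggling preserves [phi], so the partner of a remaining cell is neither [U] nor [e |: U]. *)
  - move=> W; rewrite !K'L => /and3P[WKL WU WeU].
    have [tW rW] := tog _ WKL; split=> //; rewrite tW /=.
    have [pW|pW] := boolP (phi W \in W).
      have [W'P phiW'] := togP _ WKL pW; rewrite /toggle pW.
      apply/andP; split; apply/eqP => W'E.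
        by move: WeU; rewrite -(finset.setD1K pW) W'E -phiW' W'E eqxx.
      move: W'P; rewrite inE W'E phieU => /andP[_].
      by rewrite finset.setU11.
    have phitW : phi (toggle (phi W) W) = phi W.
      apply/esym/phi_loc => //; rewrite /toggle (negbTE pW); exact: subsetU1.
    move: phitW; rewrite /toggle (negbTE pW) => phitW.
    apply/andP; split; apply/eqP => W'E.
      by move: pU; rewrite /e -W'E phitW finset.setU11.
    have eW : e = phi W by rewrite -phieU -W'E.
    case/eqP: WU; rewrite -(finset.setU1K pW) W'E -eW; exact: finset.setU1K.
  - by move=> W W'; rewrite !K'L => /and3P[? _ _] /and3P[? _ _]; exact: phi_loc.
apply: rst_step; right; left; split; first exact: full_ideal_CW.
exists U, (e |: U); split; split=> //.
- by apply/eqP => UE; move: pU; rewrite UE finset.setU11.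
- exact: cplx_iso_refl.
Qed.

End Collapses.

(** * The cylinder joining the neighborhood complex to Hom(K_2, G) *)

Section NeighborhoodHom.
Variables (R : realType) (V : finType) (adj : rel V).

Local Notation E := (V + option V)%type.
Implicit Types (U W : {set E}) (S T : {set V}).

Definition block (e : E) : bool := if e is inl _ then true else false.
Definition lpart U : {set V} := inl @^-1: U.
Definition rpart U : {set V} := (fun v => inr (Some v)) @^-1: U.
Definition apex : E := inr None.

(* The cells are the products of a simplex [lpart U] of the neighborhood complex with
   a simplex on [rpart U], possibly joined with [apex], a new neighbor of everything. *)
Definition cylinder : {set {set E}} :=
  [set U | [&& full block U, common_nbrs adj (lpart U) != finset.set0 &
            rpart U \subset common_nbrs adj (lpart U)]].
Definition cylinder_nbhd : {set {set E}} := [set U in cylinder | rpart U == finset.set0].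
Definition cylinder_hom : {set {set E}} := [set U in cylinder | apex \notin U].

Lemma lpartS U W : U \subset W -> lpart U \subset lpart W.
Proof. exact: finset.preimsetS. Qed.

Lemma rpartS U W : U \subset W -> rpart U \subset rpart W.
Proof. exact: finset.preimsetS. Qed.

Lemma common_nbrsS S T : S \subset T -> common_nbrs adj T \subset common_nbrs adj S.
Proof.
move=> /fintype.subsetP ST; apply/fintype.subsetP => v; rewrite !inE.
by move=> /'forall_implyP aT; apply/'forall_implyP => x /ST/aT.
Qed.

(** Shrinking the left part only enlarges its set of common neighbors. *)
Lemma cylinder_ideal : full_ideal block cylinder.
Proof.
move=> U W; rewrite !inE => /and3P[_ W0 WW] UW.
have cUW := common_nbrsS (lpartS UW).
case: full => //=; apply/andP; split.
  by apply: contraNneq W0 => U0; rewrite -finset.subset0 -U0.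
exact: fintype.subset_trans (rpartS UW) (fintype.subset_trans WW cUW).
Qed.

Lemma cylinder_nbhd_ideal : full_ideal block cylinder_nbhd.
Proof.
move=> U W; rewrite inE => /andP[WZ W0] UW; rewrite inE (cylinder_ideal WZ UW).
by have := rpartS UW; rewrite (eqP W0) finset.subset0 => ->; rewrite andbT.
Qed.

Lemma cylinder_hom_ideal : full_ideal block cylinder_hom.
Proof.
move=> U W; rewrite inE => /andP[WZ Wa] UW; rewrite inE (cylinder_ideal WZ UW).
by rewrite andb_idr // => _; apply: contra Wa => /(fintype.subsetP UW).
Qed.

Lemma in_lpart U v : (v \in lpart U) = (inl v \in U).
Proof. by rewrite inE. Qed.

Lemma in_rpart U v : (v \in rpart U) = (inr (Some v) \in U).
Proof. by rewrite inE. Qed.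

Lemma full_block U :
  full block U = (lpart U != finset.set0) && ((rpart U != finset.set0) || (apex \in U)).
Proof.
apply/fullP/andP.
  move=> fU; split; last first.
    have [[//|[v|]] eU _] := fU false; last by rewrite eU orbT.
    by apply/orP; left; apply/finset.set0Pn; exists v; rewrite in_rpart.
  have [[v|//] eU _] := fU true.
  by apply/finset.set0Pn; exists v; rewrite in_lpart.
case=> /finset.set0Pn[v /[!in_lpart] vU] UR [|]; first by exists (inl v).
case/orP: UR => [/finset.set0Pn[u /[!in_rpart] uU]|aU]; first by exists (inr (Some u)).
by exists apex.
Qed.

Lemma lpart_toggle_r o U : lpart (toggle (inr o) U) = lpart U.
Proof. by apply/setP => v; rewrite !in_lpart /toggle; case: ifP; rewrite !inE. Qed.

Lemma rpart_toggle_apex U : rpart (toggle apex U) = rpart U.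
Proof. by apply/setP => v; rewrite !in_rpart /toggle; case: ifP; rewrite !inE. Qed.

(** A removed cell has nonempty [rpart], so it stays full when the apex is toggled, and the apex is
    subject to no adjacency condition. *)
Lemma cylinder_collapse_nbhd :
  same_simple_homotopy_type R (face_complex cylinder) (face_complex cylinder_nbhd).
Proof.
apply: (@toggle_collapse R _ _ true block (fun=> apex) (fun=> 0)) => //.
- exact: cylinder_ideal.
- exact: cylinder_nbhd_ideal.
- by apply/fintype.subsetP => U; rewrite inE => /andP[].
move=> U; rewrite !inE lpart_toggle_r rpart_toggle_apex !full_block.
rewrite lpart_toggle_r rpart_toggle_apex.
case: (rpart U == _); first by rewrite andbT andNb.
by rewrite !andbF /= !andbT => ->.
Qed.

(** A removed cell contains the apex, so it stays full when a common neighbor is toggled. Nested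
    cells with left parts of equal size have the same left part, hence the same chosen neighbor. *)
Lemma cylinder_collapse_hom :
  same_simple_homotopy_type R (face_complex cylinder) (face_complex cylinder_hom).
Proof.
(* The default [None], that is the apex, never occurs on the cylinder, where common neighbors
   exist. *)
pose phi U : E := inr [pick v in common_nbrs adj (lpart U)].
apply: (@toggle_collapse R _ _ true block phi (fun U => #|lpart U|)).
- exact: cylinder_ideal.
- exact: cylinder_hom_ideal.
- by apply/fintype.subsetP => U; rewrite inE => /andP[].
- by move=> U W UW; apply/subset_leq_card/lpartS.
- move=> U UKL; rewrite lpart_toggle_r; split=> //.
  have /andP[aU UZ] : (apex \in U) && (U \in cylinder).
    move: UKL; rewrite finset.in_setD [U \in cylinder_hom]inE negb_and negbK.
    by case: (U \in cylinder); rewrite ?andbF //= !andbT.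
  have Z := UZ; move: Z; rewrite inE => /and3P[fU U0 UU].
  rewrite /phi; case: pickP => [v vN|none]; last first.
    by case/finset.set0Pn: U0 => v; rewrite none.
  have aT : apex \in toggle (inr (Some v)) U.
    by rewrite /toggle; case: ifP; rewrite !inE aU.
  rewrite inE [X in ~~ X]inE aT andbF /= inE full_block lpart_toggle_r aT orbT andbT.
  move: fU; rewrite full_block => /andP[-> _]; rewrite U0 /=.
  apply/fintype.subsetP => u; rewrite in_rpart /toggle; case: ifP => _.
    by rewrite !inE => /andP[_]; rewrite -in_rpart => /(fintype.subsetP UU); rewrite !inE.
  rewrite finset.in_setU1 => /orP[/eqP[->]//|].
  by rewrite -in_rpart => /(fintype.subsetP UU).
move=> U W _ _ UW /eqP rUW; rewrite /phi.
suff -> : lpart U = lpart W by [].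
by apply/eqP; rewrite eqEcard lpartS //= (eqP rUW).
Qed.

(** * Identification of the two ends of the cylinder *)

Definition join_cell S (T : {set option V}) : {set E} := inl @: S :|: inr @: T.

Lemma in_join_l S (T : {set option V}) v : (inl v \in join_cell S T) = (v \in S).
Proof.
rewrite inE (mem_imset _ _ inl_inj) orb_idr //.
by case/imsetP.
Qed.

Lemma in_join_r S (T : {set option V}) o : (inr o \in join_cell S T) = (o \in T).
Proof.
rewrite inE (mem_imset _ _ inr_inj) orb_idl //.
by case/imsetP.
Qed.

Lemma join_cell_sub S S' (T T' : {set option V}) :
  (join_cell S T \subset join_cell S' T') = (S \subset S') && (T \subset T').
Proof.
apply/fintype.subsetP/andP => [sub|[/fintype.subsetP SS /fintype.subsetP TT]].
  split; apply/fintype.subsetP => x.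
    by have := sub (inl x); rewrite !in_join_l.
  by have := sub (inr x); rewrite !in_join_r.
by case=> x; rewrite ?in_join_l ?in_join_r; auto.
Qed.

Lemma lpart_join S (T : {set option V}) : lpart (join_cell S T) = S.
Proof. by apply/setP => v; rewrite in_lpart in_join_l. Qed.
Lemma rpart_join S (T : {set option V}) : rpart (join_cell S T) = Some @^-1: T.
Proof. by apply/setP => v; rewrite in_rpart in_join_r inE. Qed.

Lemma nbhd_iso : cplx_iso (nbhd_complex adj) (face_complex cylinder_nbhd).
Proof.
exists (fun S => join_cell S [set None]); split.
- by move=> S S' _ _ /(congr1 lpart); rewrite !lpart_join.
- apply/setP => U; apply/imsetP/idP => [[S /[!inE]/andP[S0 SN] ->]|].
    have r0 : rpart (join_cell S [set None]) = finset.set0.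
      by rewrite rpart_join; apply/setP => v; rewrite !inE.
    rewrite full_block lpart_join r0 S0 SN finset.sub0set eqxx /= !andbT.
    by rewrite in_join_r inE.
  rewrite !inE full_block => /andP[/and3P[/andP[l0 Ur] lN _] r0].
  exists (lpart U); first by rewrite inE l0.
  (* As [rpart U] is empty, fullness puts the apex in [U]. *)
  rewrite r0 /= in Ur.
  apply/setP => -[v|[v|]]; rewrite ?in_join_l ?in_join_r ?in_lpart ?inE ?Ur //.
  by rewrite -in_rpart (eqP r0) inE.
- by move=> S S' _ _; rewrite /= join_cell_sub subxx andbT.
Qed.

Lemma hom_iso : cplx_iso (hom_K2 adj) (face_complex cylinder_hom).
Proof.
have SomeK (T : {set V}) : Some @^-1: (Some @: T) = T.
  by apply/setP => v; rewrite inE (mem_imset _ _ Some_inj).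
have SomeS (T T' : {set V}) : (Some @: T \subset Some @: T') = (T \subset T').
  by apply/idP/idP => [/(finset.preimsetS Some)|]; rewrite ?SomeK //; exact: imsetS.
have nN (T : {set V}) : None \notin Some @: T by apply/imsetP => -[].
have adjE (S T : {set V}) : [forall x in S, forall y in T, adj x y] =
    (T \subset common_nbrs adj S).
  apply/'forall_implyP/fintype.subsetP => [H y yT|H x xS].
    by rewrite inE; apply/'forall_implyP => x /H/'forall_implyP; apply.
  by apply/'forall_implyP => y /H; rewrite inE => /'forall_implyP; apply.
exists (fun p : {set V} * {set V} => join_cell p.1 (Some @: p.2)); split.
- move=> [S T] [S' T'] _ _ /= eq.
  move: (congr1 lpart eq) (congr1 rpart eq).
  by rewrite !lpart_join !rpart_join !SomeK => -> ->.
- apply/setP => U; apply/imsetP/idP => [[[S T] /[!inE]/and3P[/= S0 T0 ST] ->]|].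
    rewrite full_block lpart_join rpart_join SomeK S0 T0 /= in_join_r (negbTE (nN _)) andbT.
    move: ST; rewrite adjE => ST; rewrite ST andbT.
    (* Common neighbors of [S] exist because [T] is a nonempty set of them. *)
    by apply: contraNneq T0 => N0; rewrite -finset.subset0 -N0.
  rewrite !inE full_block => /andP[/and3P[/andP[l0 Ur] lN lr] a0].
  rewrite (negbTE a0) orbF in Ur.
  exists (lpart U, rpart U); first by rewrite inE /= l0 Ur adjE.
  apply/setP => -[v|[v|]]; rewrite ?in_join_l ?in_join_r ?in_lpart //=.
    by rewrite (mem_imset _ _ Some_inj) in_rpart.
  by rewrite (negbTE a0) (negbTE (nN _)).
- by move=> [S T] [S' T'] _ _; rewrite /= join_cell_sub SomeS.
Qed.

End NeighborhoodHom.

Theorem mainTheorem8 (R : realType) (V : finType) (adj : rel V)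
    (adj_sym : symmetric adj) :
  same_simple_homotopy_type R (nbhd_complex adj) (hom_K2 adj).
Proof.
apply: (rst_trans _ _ _ (face_complex (cylinder_nbhd adj))).
  by apply: rst_step; left; exact: nbhd_iso.
apply: (rst_trans _ _ _ (face_complex (cylinder adj))).
  by apply: rst_sym; exact: cylinder_collapse_nbhd.
apply: (rst_trans _ _ _ (face_complex (cylinder_hom adj))).
  exact: cylinder_collapse_hom.
by apply: rst_sym; apply: rst_step; left; exact: hom_iso.
Qed.
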